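(* Let $N\ge 3$ be an integer and let $p_0,p_1,p_2,p_3\in(0,1)$. Let $G$ be either the group of cyclic permutations (rotations) of $(1,2,\ldots,N)$ or, in the case $p_1=p_2$, the dihedral group of order $2N$ of rotations and reflections of $(1,2,\ldots,N)$. Given integers $r,s\ge1$, let $\{(\boldsymbol X(n),I(n))\}_{n\ge0}$ be the nonhomogeneous Markov chain in $\Sigma^*=\Sigma\times\{1,\ldots,N\}$ with one-step transition matrices $\boldsymbol P_A^*,\ldots,\boldsymbol P_A^*$ ($r$ times), $\boldsymbol P_B^*,\ldots,\boldsymbol P_B^*$ ($s$ times), $\boldsymbol P_A^*,\ldots,\boldsymbol P_A^*$ ($r$ times), $\boldsymbol P_B^*,\ldots,\boldsymbol P_B^*$ ($s$ times), and so on, and arbitrary initial distribution. Define $$\xi_n:=w\big((\boldsymbol X(n-1),I(n-1)),(\boldsymbol X(n),I(n))\big),\qquad n\ge1,$$ where $w$ is the payoff function ($1$ for a win, $-1$ for a loss), and let $S_n:=\xi_1+\cdots+\xi_n$ for each $n\ge1$. Then $n^{-1}S_n\to\mu_{[r,s]}$ almost surely as $n\to\infty$, where $$\mu_{[r,s]}=\frac{1}{r+s}\sum_{v=0}^{s-1}\bar{\boldsymbol\pi}\,\bar{\boldsymbol P}_A^{\,r}\,\bar{\boldsymbol P}_B^{\,v}\,\dot{\bar{\boldsymbol P}}_B\boldsymbol 1,$$ $\bar{\boldsymbol\pi}$ (a row vector) is the unique stationary distribution of $\bar{\boldsymbol P}_A^{\,r}\bar{\boldsymbol P}_B^{\,s}$,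 and $\boldsymbol 1$ is the column vector of $1$s with entries indexed by $\Sigma/\!\sim$.
   Context: Let $\Sigma:=\{0,1\}^N$, with elements $\boldsymbol x=(x_1,\ldots,x_N)$ and the conventions $x_0:=x_N$, $x_{N+1}:=x_1$ (0 = loser, 1 = winner, $N$ players in a circle). Put $m_i(\boldsymbol x):=2x_{i-1}+x_{i+1}\in\{0,1,2,3\}$, let $\boldsymbol x^i$ be $\boldsymbol x$ with its $i$th coordinate $x_i$ replaced by $1-x_i$, and let $q_m:=1-p_m$ for $m=0,1,2,3$. The matrix $\boldsymbol P_B$ on $\Sigma$ is: $P_B(\boldsymbol x,\boldsymbol x^i):=N^{-1}p_{m_i(\boldsymbol x)}$ if $x_i=0$ and $N^{-1}q_{m_i(\boldsymbol x)}$ if $x_i=1$ ($i=1,\ldots,N$); $P_B(\boldsymbol x,\boldsymbol x):=N^{-1}\big(\sum_{i:x_i=0}q_{m_i(\boldsymbol x)}+\sum_{i:x_i=1}p_{m_i(\boldsymbol x)}\big)$; and $P_B(\boldsymbol x,\boldsymbol y)=0$ otherwise. $\boldsymbol P_A$ denotes $\boldsymbol P_B$ in the special case $p_0=p_1=p_2=p_3=1/2$. The matrix $\boldsymbol P_B^*$ on $\Sigma^*:=\Sigma\times\{1,\ldots,N\}$ (the second coordinate is the label of the next player to play) is: for $(\boldsymbol x,i)\in\Sigma^*$ and $j=1,\ldots,N$, $P_B^*((\boldsymbol x,i),(\boldsymbol x^i,j)):=N^{-1}p_{m_i(\boldsymbol x)}$ if $x_i=0$ and $N^{-1}q_{m_i(\boldsymbol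 x)}$ if $x_i=1$; $P_B^*((\boldsymbol x,i),(\boldsymbol x,j)):=N^{-1}q_{m_i(\boldsymbol x)}$ if $x_i=0$ and $N^{-1}p_{m_i(\boldsymbol x)}$ if $x_i=1$; all other entries are $0$. $\boldsymbol P_A^*$ denotes $\boldsymbol P_B^*$ in the special case $p_0=p_1=p_2=p_3=1/2$. The payoff function $w$ on $\Sigma^*\times\Sigma^*$ is $1$, $-1$, or $0$ according to whether the corresponding entry of $\boldsymbol P_B^*$ is of the form $N^{-1}p_m$, $N^{-1}q_m$, or $0$. That is, $w((\boldsymbol x,i),(\boldsymbol x^i,j))=1$ if $x_i=0$ and $-1$ if $x_i=1$; $w((\boldsymbol x,i),(\boldsymbol x,j))=-1$ if $x_i=0$ and $1$ if $x_i=1$; and $w=0$ otherwise. For $\sigma\in G$ write $\boldsymbol x_\sigma:=(x_{\sigma(1)},\ldots,x_{\sigma(N)})$. Write $\boldsymbol x\sim\boldsymbol y$ if $\boldsymbol y=\boldsymbol x_\sigma$ for some $\sigma\in G$; $[\boldsymbol x]$ is the equivalence class of $\boldsymbol x$, and $\Sigma/\!\sim$ is the set of equivalence classes. A square matrix $\boldsymbol P$ indexed by $\Sigma$ is $G$-invariant if $P(\boldsymbol x_\sigma,\boldsymbol y_\sigma)=P(\boldsymbol x,\boldsymbol y)$ for all $\sigma\in G$, $\boldsymbol x,\boldsymbol y\in\Sigma$; in that case $\bar{\boldsymbol P}$, indexed by $\Sigma/\!\sim$, is defined by $\bar P([\boldsymbol x],[\boldsymbol y]):=\sum_{\boldsymbol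 y':\boldsymbol y'\sim\boldsymbol y}P(\boldsymbol x,\boldsymbol y')$. The matrices $\boldsymbol P_A$ and $\boldsymbol P_B$ are $G$-invariant when $G$ is the group of cyclic permutations (rotations) of $(1,2,\ldots,N)$ and, in the case $p_1=p_2$, also when $G$ is the dihedral group of order $2N$ of rotations and reflections of $(1,2,\ldots,N)$. $\dot{\bar{\boldsymbol P}}_B$ is obtained from $\bar{\boldsymbol P}_B$ by replacing each $q_m$ by $-q_m$ (prior to any simplification using $q_m=1-p_m$). Equivalently, let $\dot{\boldsymbol P}_B$ be the matrix on $\Sigma$ with $\dot P_B(\boldsymbol x,\boldsymbol x^i)=N^{-1}p_{m_i(\boldsymbol x)}$ if $x_i=0$, $\dot P_B(\boldsymbol x,\boldsymbol x^i)=-N^{-1}q_{m_i(\boldsymbol x)}$ if $x_i=1$, $\dot P_B(\boldsymbol x,\boldsymbol x)=N^{-1}\big(-\sum_{i:x_i=0}q_{m_i(\boldsymbol x)}+\sum_{i:x_i=1}p_{m_i(\boldsymbol x)}\big)$, and other entries $0$; then $\dot{\bar P}_B([\boldsymbol x],[\boldsymbol y])=\sum_{\boldsymbol y':\boldsymbol y'\sim\boldsymbol y}\dot P_B(\boldsymbol x,\boldsymbol y')$. *)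

(* Defs.v *)
From HB Require Import structures.
From mathcomp Require Import all_boot all_order all_algebra all_fingroup.
From mathcomp Require Import boolp classical_sets reals ereal topology.
From mathcomp Require Import normedtype sequences measure probability.

Set Implicit Arguments.
Unset Strict Implicit.
Unset Printing Implicit Defensive.

Import Order.TTheory GRing.Theory Num.Theory.
Import numFieldNormedType.Exports.

Local Open Scope ring_scope.

(* Players are 0, ..., N-1 around a circle, so that ordS and ord_pred give the
   cyclic neighbours i+1 and i-1; true = winner, false = loser. *)
Notation config N := {ffun 'I_N -> bool}.

Section Configurations.
Variable N : nat.
Implicit Types (x y : config N) (i j : 'I_N) (s : {perm 'I_N}).

Definition flip x i : config N := [ffun j => if j == i then ~~ x j else x j].

(* The argument of inord is at most 3, so inord does not truncate. *)
Definition nbhd x i : 'I_4 := inord (2 * x (ord_pred i) + x (ordS i))%N.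

Definition permute s x : config N := [ffun i => x (s i)].

Definition rotation : {perm 'I_N} := perm (@ordS_inj N).
Definition reflection : {perm 'I_N} := perm (@rev_ord_inj N).

Definition rotations : {group {perm 'I_N}} := <[rotation]>%G.
Definition dihedral : {group {perm 'I_N}} := <<[set rotation; reflection]>>%G.

Definition sim (G : {group {perm 'I_N}}) : rel (config N) :=
  fun x y => [exists s in G, y == permute s x].

(* Sigma / ~, as a set of subsets of Sigma; a matrix indexed by
   it has type 'M_#|orbits G|, rows and columns being numbered by orbit_val. *)
Definition orbits (G : {group {perm 'I_N}}) : {set {set config N}} :=
  equivalence_partition (sim G) [set: config N].

Definition orbit_val G (i : 'I_#|orbits G|) : {set config N} := enum_val i.

Definition orbit_rep (U : {set config N}) : config N :=
  odflt [ffun=> false] [pick x in U].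

End Configurations.

Section Games.
Variables (R : realType) (N : nat).
Implicit Types (p q : 'I_4 -> R) (x y : config N) (i : 'I_N).

(* q is kept as an independent argument so that "replace each q_m by -q_m" is
   a substitution.  The configurations flip x i are pairwise distinct, so off
   the diagonal the sum has at most one term. *)
Definition walk_mx p q x y : R :=
  if y == x then
    N%:R^-1 * (\sum_(i | ~~ x i) q (nbhd x i) + \sum_(i | x i) p (nbhd x i))
  else
    \sum_(i | y == flip x i)
       N%:R^-1 * (if x i then q (nbhd x i) else p (nbhd x i)).

Definition fair : 'I_4 -> R := fun=> 2^-1.

Definition P_B p : config N -> config N -> R := walk_mx p (fun m => 1 - p m).
Definition P_A : config N -> config N -> R := P_B fair.
Definition Pdot_B p : config N -> config N -> R :=
  walk_mx p (fun m => - (1 - p m)).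

Definition Pstar_B p (a b : config N * 'I_N) : R :=
  let: (x, i) := a in let: (y, _) := b in
  if y == flip x i then
    N%:R^-1 * (if x i then 1 - p (nbhd x i) else p (nbhd x i))
  else if y == x then
    N%:R^-1 * (if x i then p (nbhd x i) else 1 - p (nbhd x i))
  else 0.
Definition Pstar_A : config N * 'I_N -> config N * 'I_N -> R := Pstar_B fair.

Definition payoff (a b : config N * 'I_N) : R :=
  let: (x, i) := a in let: (y, _) := b in
  if y == flip x i then (if x i then -1 else 1)
  else if y == x then (if x i then 1 else -1)
  else 0.

Definition invariant_mx (G : {group {perm 'I_N}})
    (M : config N -> config N -> R) : Prop :=
  forall s, s \in G -> forall x y, M (permute s x) (permute s y) = M x y.

(* The matrix induced on Sigma / ~; for a G-invariant matrix the choice of the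
   representative does not matter, see quot_mxE. *)
Definition quot_mx (G : {group {perm 'I_N}})
    (M : config N -> config N -> R) : 'M[R]_#|orbits G| :=
  \matrix_(i, j) \sum_(y in orbit_val j) M (orbit_rep (orbit_val i)) y.

Definition stationary n (M : 'M[R]_n) (v : 'rV[R]_n) : Prop :=
  [/\ forall k, 0 <= v 0 k, \sum_k v 0 k = 1 & v *m M = v].

(* The n-th factor (n = 0, 1, ...) is the transition from time n to n + 1. *)
Definition periodic_kernel p (r s n : nat) :
    config N * 'I_N -> config N * 'I_N -> R :=
  if (n %% (r + s) < r)%N then Pstar_A else Pstar_B p.

End Games.

Section MarkovChains.
Local Open Scope classical_set_scope.
Variables (R : realType) (d : measure_display) (T : measurableType d).
Variables (P : probability T R) (E : finType).

Definition cond_prob (A B : set T) : R := fine (P (A `&` B)) / fine (P B).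

Definition markov_chain (Z : nat -> T -> E) (K : nat -> E -> E -> R) : Prop :=
  (forall n e, measurable [set t | Z n t = e]) /\
  forall (n : nat) (e : nat -> E) (b : E),
    let past := [set t | forall k, (k <= n)%N -> Z k t = e k] in
    P past != 0%E -> cond_prob [set t | Z n.+1 t = b] past = K n (e n) b.

End MarkovChains.

Section Profit.
Variables (R : realType) (N : nat) (T : Type).
Variables (X : nat -> T -> config N) (I : nat -> T -> 'I_N).

(* Meaningful for n >= 1 only. *)
Definition profit (n : nat) (t : T) : R :=
  payoff R (X n.-1 t, I n.-1 t) (X n t, I n t).

Definition total_profit (n : nat) (t : T) : R :=
  \sum_(1 <= k < n.+1) profit k t.

End Profit.

Section QuotientFacts.
Variables (R : realType) (N : nat).
Implicit Types (G : {group {perm 'I_N}}) (x y : config N) (i : 'I_N).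
Implicit Types (s t : {perm 'I_N}).

Lemma permuteM s t x : permute s (permute t x) = permute (s * t)%g x.
Proof. by apply/ffunP => i; rewrite !ffunE permM. Qed.

Lemma permute1 x : permute 1%g x = x.
Proof. by apply/ffunP => i; rewrite ffunE perm1. Qed.

Lemma permute_inj s : injective (permute s).
Proof.
move=> x y /(congr1 (permute s^-1%g)).
by rewrite !permuteM mulVg !permute1.
Qed.

Lemma sim_equiv G : {in [set: config N] & &, equivalence_rel (sim G)}.
Proof.
have symG x y : sim G x y -> sim G y x.
  case/exists_inP=> s sG /eqP->; apply/exists_inP; exists s^-1%g.
    by rewrite groupV.
  by rewrite permuteM mulVg permute1.
have trG y x z : sim G x y -> sim G y z -> sim G x z.
  case/exists_inP=> s sG /eqP-> /exists_inP[t tG /eqP->].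
  by apply/exists_inP; exists (t * s)%g; rewrite ?groupM // permuteM.
move=> x y z _ _ _; split.
  by apply/exists_inP; exists 1%g; rewrite ?group1 // permute1.
move=> xy; apply/idP/idP; first exact: trG (symG _ _ xy).
exact: trG xy.
Qed.

Lemma quot_mxE G (M : config N -> config N -> R) (i j : 'I_#|orbits G|) x :
  invariant_mx G M -> x \in orbit_val i ->
  quot_mx G M i j = \sum_(y in orbit_val j) M x y.
Proof.
move=> Minv xi; rewrite mxE.
have orbP (k : 'I_#|orbits G|) y z :
    y \in orbit_val k -> (z \in orbit_val k) = sim G y z.
  have /imsetP[u _ ku] := enum_valP k; rewrite /orbit_val ku !inE => uy.
  by have [_ ->] := sim_equiv G (finset.in_setT u) (finset.in_setT y) (finset.in_setT z).
have ri : orbit_rep (orbit_val i) \in orbit_val i.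
  by rewrite /orbit_rep; case: pickP => [//|/(_ x)]; rewrite xi.
have := xi; rewrite (orbP i _ _ ri) => /exists_inP[s sG /eqP->].
rewrite [RHS](reindex_inj (@permute_inj s)); apply: eq_big => y; last first.
  by rewrite Minv.
apply/idP/idP => yj.
  by rewrite (orbP j _ _ yj); apply/exists_inP; exists s.
rewrite (orbP j _ _ yj); apply/exists_inP; exists s^-1%g; rewrite ?groupV //.
by rewrite permuteM mulVg permute1.
Qed.

Definition compat (p q : 'I_4 -> R) : {set {perm 'I_N}} :=
  [set s : {perm 'I_N} | [forall x : config N, forall i : 'I_N,
     (p (nbhd (permute s x) i) == p (nbhd x (s i))) &&
     (q (nbhd (permute s x) i) == q (nbhd x (s i)))]].

Lemma compat_group_set p q : group_set (compat p q).
Proof.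
apply/group_setP; split.
  by rewrite inE; apply/forallP=> x; apply/forallP=> i; rewrite permute1 perm1 !eqxx.
move=> s t; rewrite !inE => /forallP sP /forallP tP.
apply/forallP => x; apply/forallP => i; rewrite -permuteM permM.
have /andP[/eqP-> /eqP->] := forallP (sP (permute t x)) i.
exact: (forallP (tP x)).
Qed.
Canonical compat_group p q := group (compat_group_set p q).

Lemma compat_invariant p q s : s \in compat p q ->
  forall x y, walk_mx p q (permute s x) (permute s y) = walk_mx p q x y.
Proof.
rewrite inE => /forallP sP x y.
have pE i : p (nbhd (permute s x) i) = p (nbhd x (s i)).
  by have /andP[/eqP->] := forallP (sP x) i.
have qE i : q (nbhd (permute s x) i) = q (nbhd x (s i)).
  by have /andP[_ /eqP->] := forallP (sP x) i.
have flipE i : flip (permute s x) i = permute s (flip x (s i)).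
  by apply/ffunP => j; rewrite !ffunE (inj_eq perm_inj).
rewrite /walk_mx (inj_eq (@permute_inj s)); case: ifP => _.
  congr (_ * (_ + _)); rewrite [RHS](reindex_inj (@perm_inj _ s));
  by apply: eq_big => i; rewrite ?ffunE // => _; rewrite ?pE ?qE.
rewrite [RHS](reindex_inj (@perm_inj _ s)); apply: eq_big => i.
  by rewrite flipE (inj_eq (@permute_inj s)).
by rewrite ffunE pE qE.
Qed.

Lemma rotation_compat p q : rotation N \in compat p q.
Proof.
rewrite inE; apply/forallP=> x; apply/forallP=> i.
by rewrite /nbhd !ffunE !permE ordSK ord_predK !eqxx.
Qed.

Lemma walk_mx_rotations p q : invariant_mx (rotations N) (@walk_mx R N p q).
Proof.
move=> s sG; apply: compat_invariant.
have sub : (rotations N \subset compat p q)%g.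
  by rewrite [X in X \subset _]/= (cycle_subG _ (compat_group p q)) rotation_compat.
exact: (fintype.subsetP sub).
Qed.

Lemma rev_ordS i : rev_ord (ordS i) = ord_pred (rev_ord i).
Proof.
apply: val_inj => /=; case: N i => [[]//|n] i.
have := ltn_ord i; rewrite leq_eqVlt => /orP[/eqP[->]|ltin].
  by rewrite modnn subnn add0n modn_small //= subSS subn0.
rewrite [(i.+1 %% _)%N]modn_small // !subSS addnS /= -(@subnSK i n) // addSnnS.
by rewrite modnDr modn_small // ltnS leq_subr.
Qed.

Lemma rev_ord_pred i : rev_ord (ord_pred i) = ordS (rev_ord i).
Proof. by rewrite -{2}(ord_predK i) rev_ordS ord_predK. Qed.

Lemma reflection_compat (p q : 'I_4 -> R) : p (inord 1) = p (inord 2) ->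
  q (inord 1) = q (inord 2) -> reflection N \in compat p q.
Proof.
move=> p12 q12; rewrite inE; apply/forallP=> x; apply/forallP=> i.
rewrite /nbhd !ffunE !permE rev_ordS rev_ord_pred.
by case: (x _); case: (x _); rewrite /= ?(p12, q12) !eqxx.
Qed.

Lemma walk_mx_dihedral (p q : 'I_4 -> R) : p (inord 1) = p (inord 2) ->
  q (inord 1) = q (inord 2) -> invariant_mx (dihedral N) (@walk_mx R N p q).
Proof.
move=> p12 q12 s sG; apply: compat_invariant.
have sub : (dihedral N \subset compat p q)%g.
  rewrite (gen_subG _ (compat_group p q)); apply/fintype.subsetP => t.
  by case/set2P=> ->; rewrite ?rotation_compat ?reflection_compat.
exact: (fintype.subsetP sub).
Qed.

End QuotientFacts.

(* Main.v *)
Require Import Defs.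
From HB Require Import structures.
From mathcomp Require Import all_boot all_order all_algebra all_fingroup.
From mathcomp Require Import boolp classical_sets reals ereal topology.
From mathcomp Require Import normedtype sequences measure probability.
From mathcomp Require Import zify ring lra.

(** The proof reduces the strong law to solving a Poisson equation on the finite
    quotient.

    Suppose that functions H_n on configurations with a labelled player satisfy
    K_n (w + H_(n+1)) = mu + H_n, where K_n is the kernel used at time n and w
    the payoff. Then S_n - n mu differs by a bounded amount from a martingale
    with bounded increments. Such a martingale M_n is o(n) almost surely: its
    variance is O(n), so Chebyshev's inequality and the Borel-Cantelli lemma
    control it along the times k^4, and between two such times it moves too
    little to matter ([martingale_strong_law], [poisson_strong_law]). As the
    chain takes finitely many values, the expectations involved are finite sums
    over trajectories.

    To find H, one starts on the orbits. The matrix Q of one period is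
    stochastic and irreducible, because a single player may change status in the
    first round while nothing happens in the others. The maximum principle then
    shows that 1 - Q + J is invertible, where J is the all-ones matrix, and this
    gives at once the existence and uniqueness of the stationary row pi and the
    solvability of h - Q h = b whenever pi b = 0 ([stationary_vector_unique],
    [poisson_solvable]). Running the recursion backward through the rounds of a
    period turns the Poisson equation into such an equation, whose solvability
    condition is the formula for mu ([periodic_poisson]).

    The solution on orbits lifts to configurations because the one-step matrices
    are invariant, and from there to configurations with a labelled player
    because the next player is uniform and independent of the past: averaging
    over the label turns the expected payoff of that player into the row sums of
    Pdot_B, and the starred kernel into P_B ([player_poisson]). *)

Set Implicit Arguments.
Unset Strict Implicit.
Unset Printing Implicit Defensive.

Import Order.TTheory GRing.Theory Num.Theory.
Import numFieldNormedType.Exports.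

Local Open Scope classical_set_scope.
Local Open Scope ring_scope.

(** * Irreducible stochastic matrices *)

Lemma connect_closed (T : finType) (e : rel T) (A : T -> Prop) x y :
  (forall a b : T, e a b -> A a -> A b) -> connect e x y -> A x -> A y.
Proof.
move=> clA /connectP[s es ->]; elim: s x es => [|z s IHs] x //= /andP[xz zs] Ax.
exact: IHs zs (clA _ _ xz Ax).
Qed.

Section IrreducibleStochastic.
Variables (R : realFieldType) (n : nat).
Implicit Types (Q M : 'M[R]_n) (h b : 'cV[R]_n) (v : 'rV[R]_n).

Local Notation one := (const_mx 1 : 'cV[R]_n).

Definition stochastic M : Prop :=
  (forall i j, 0 <= M i j) /\ M *m one = one.

Definition irreducible M : Prop :=
  forall i j, connect (fun i j => 0 < M i j) i j.

Lemma stochastic_row_sum M i : stochastic M -> \sum_j M i j = 1.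
Proof.
case=> _ /matrixP/(_ i 0); rewrite !mxE => <-.
by apply: eq_bigr => j _; rewrite mxE mulr1.
Qed.

Lemma stochasticM M Q : stochastic M -> stochastic Q -> stochastic (M *m Q).
Proof.
move=> [M0 M1] [Q0 Q1]; split; last by rewrite -mulmxA Q1.
by move=> i j; rewrite mxE sumr_ge0 // => k _; rewrite mulr_ge0.
Qed.

Lemma stochasticX M k : stochastic M -> stochastic (M ^+ k).
Proof.
move=> Ms; elim: k => [|k IHk]; last by rewrite exprS; exact: stochasticM.
split=> [i j|]; last exact: mul1mx.
by rewrite expr0 -[1]/(1%:M) mxE ler0n.
Qed.

Lemma laplacianE M h i : stochastic M ->
  (h - M *m h) i 0 = \sum_j M i j * (h i 0 - h j 0).
Proof.
move=> Ms; rewrite !mxE -[X in X - _]mul1r -(stochastic_row_sum i Ms) mulr_suml.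
by rewrite -sumrB; apply: eq_bigr => j _; rewrite mulrBr.
Qed.

Lemma col_max h (i0 : 'I_n) : exists i, forall j, h j 0 <= h i 0.
Proof.
case: (@arg_maxP _ _ _ i0 xpredT (fun i => h i 0)) => // i _ imax.
by exists i => j; exact: imax.
Qed.

(** At a maximum of h every term of the Laplacian sum is nonnegative, so a
    constant Laplacian cannot be negative. *)
Lemma laplacian_const_ge0 M h c (i0 : 'I_n) : stochastic M ->
  h - M *m h = const_mx c -> 0 <= c.
Proof.
move=> Ms hc; have [i imax] := col_max h i0.
have := laplacianE h i Ms; rewrite hc mxE => ->.
by apply: sumr_ge0 => j _; rewrite mulr_ge0 ?subr_ge0 ?(proj1 Ms) ?imax.
Qed.

(** The maximum principle: applied to h and to its opposite, the previous bound
    gives c = 0; the set of maximizers of h is then closed under the positive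
    transitions of M, hence is everything by irreducibility. *)
Lemma laplacian_const M h c (i0 : 'I_n) : stochastic M -> irreducible M ->
  h - M *m h = const_mx c -> c = 0 /\ h = const_mx (h i0 0).
Proof.
move=> Ms Mi hc.
have c0 : c = 0.
  apply/le_anti/andP; split; last exact: (laplacian_const_ge0 i0 Ms hc).
  rewrite -oppr_ge0; apply: (@laplacian_const_ge0 M (- h) _ i0) => //.
  by rewrite mulmxN -opprD hc; apply/matrixP => i j; rewrite !mxE.
split=> //.
have [i imax] := col_max h i0.
have all_max (j : 'I_n) : h j 0 = h i 0.
  apply: (@connect_closed _ _ (fun j => h j 0 = h i 0) _ _ _ (Mi i j)) => //.
  move=> a b Mab ha; have := laplacianE h a Ms; rewrite hc c0 mxE => /esym/eqP.
  rewrite psumr_eq0 => [/allP/(_ b)|k _]; last first.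
    by rewrite mulr_ge0 ?(proj1 Ms) // subr_ge0 ha imax.
  by rewrite mem_index_enum => /(_ isT)/=; rewrite mulf_eq0 gt_eqF //= subr_eq0
    => /eqP<-.
by apply/matrixP => j k; rewrite !mxE ord1 !all_max.
Qed.

Variables (Q : 'M[R]_n) (i0 : 'I_n).
Hypotheses (Qs : stochastic Q) (Qi : irreducible Q).

Local Notation ones := (const_mx 1 : 'rV[R]_n).
(* 1 - Q is singular, with kernel the constant columns; adding the all-ones
   matrix makes it invertible, and still lets one recover both the rows fixed by
   Q, as multiples of ones *m invmx fund, and the values of 1 - Q, as the columns
   orthogonal to such a row. *)
Local Notation fund := (1%:M - Q + one *m ones).

Lemma const_mxE_mul (h : 'M[R]_1) : one *m h = const_mx (h 0 0).
Proof. by apply/matrixP => i j; rewrite !mxE big_ord1 mxE mul1r (ord1 j). Qed.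

Lemma size_neq0 : n%:R != 0 :> R.
Proof. by rewrite pnatr_eq0 -lt0n (leq_ltn_trans _ (ltn_ord i0)). Qed.

(** If fund kills a column h, then h - Q h is constant; the maximum principle
    makes h constant and the sum of its entries zero, so h = 0. *)
Lemma fund_unit : fund \in unitmx.
Proof.
rewrite -unitmx_tr -row_free_unit -kermx_eq0; apply/eqP/row_matrixP => i.
rewrite row0; set u := row i _.
have /(congr1 trmx) : u *m fund^T = 0 by apply/sub_kermxP; exact: row_sub.
rewrite trmx_mul trmxK trmx0 mulmxDl mulmxBl mul1mx -mulmxA const_mxE_mul => /eqP.
rewrite addr_eq0 => /eqP Lu.
have Lu' : u^T - Q *m u^T = const_mx (- (ones *m u^T) 0 0).
  by rewrite Lu; apply/matrixP => k l; rewrite !mxE.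
have [/eqP s0 uc] := laplacian_const i0 Qs Qi Lu'.
move: s0; rewrite oppr_eq0 mxE (eq_bigr (fun=> u^T i0 0)) => [|k _]; last first.
  by rewrite uc !mxE mul1r.
rewrite sumr_const card_ord -mulr_natr mulf_eq0 (negPf size_neq0) orbF => /eqP u0.
by apply: trmx_inj; rewrite uc u0 trmx0; apply/matrixP => k l; rewrite !mxE.
Qed.

Lemma row_mul_one v : v *m one = (\sum_k v 0 k)%:M.
Proof.
apply/matrixP => i j; rewrite !ord1 !mxE mulr1n.
by apply: eq_bigr => k _; rewrite mxE mulr1.
Qed.

(** A fixed row is determined by the sum of its entries, since fund is
    invertible. *)
Lemma fixed_fund v : v *m Q = v -> v *m fund = (\sum_k v 0 k) *: ones.
Proof.
move=> vQ; rewrite mulmxDr mulmxBr mulmx1 vQ subrr add0r mulmxA row_mul_one.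
by rewrite mul_scalar_mx.
Qed.

Lemma fixed_proportional v w : v *m Q = v -> w *m Q = w ->
  (\sum_k w 0 k) *: v = (\sum_k v 0 k) *: w.
Proof.
move=> vQ wQ; apply: (can_inj (mulmxK fund_unit)).
by rewrite -!scalemxAl !fixed_fund // !scalerA mulrC.
Qed.

(** The triangle inequality gives |v| <= |v| Q entrywise; both sides have the
    same sum because Q is stochastic, so they agree. *)
Lemma fixed_abs v : v *m Q = v -> map_mx Num.norm v *m Q = map_mx Num.norm v.
Proof.
move=> vQ; set w := map_mx _ v.
have le_w j : w 0 j <= (w *m Q) 0 j.
  rewrite [w 0 j]mxE -{1}vQ !mxE (le_trans (ler_norm_sum _ _ _)) //.
  by apply: ler_sum => k _; rewrite normrM mxE (ger0_norm (proj1 Qs _ _)).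
have sum_eq : \sum_j ((w *m Q) 0 j - w 0 j) = 0.
  rewrite sumrB; apply/eqP; rewrite subr_eq0; apply/eqP.
  transitivity ((w *m Q *m one) 0 0); first by rewrite row_mul_one mxE.
  by rewrite -mulmxA (proj2 Qs) row_mul_one mxE.
apply/matrixP => i j; rewrite ord1; apply/eqP; rewrite -subr_eq0.
have /eqP := sum_eq; rewrite psumr_eq0 => [/allP/(_ j)|k _].
  by rewrite mem_index_enum => /(_ isT).
by rewrite subr_ge0.
Qed.

Definition stationary_vector : 'rV[R]_n := ones *m invmx fund.

Lemma stationary_vector_sum : \sum_k stationary_vector 0 k = 1.
Proof.
have fundK : stationary_vector *m fund = ones by rewrite mulmxKV // fund_unit.
have sum1 : \sum_k ones 0 k = n%:R.
  by rewrite (eq_bigr (fun=> 1)) => [|k _]; rewrite ?mxE // sumr_const card_ord.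
have fund1 : fund *m one = n%:R *: one.
  rewrite mulmxDl mulmxBl mul1mx (proj2 Qs) subrr add0r -mulmxA row_mul_one sum1.
  by rewrite mul_mx_scalar.
apply: (mulfI size_neq0); rewrite mulr1.
have /(congr1 (mulmx^~ one)) := fundK.
rewrite -mulmxA fund1 -scalemxAr !row_mul_one sum1 => /matrixP/(_ 0 0).
by rewrite !mxE.
Qed.

Lemma stationary_vector_fixed : stationary_vector *m Q = stationary_vector.
Proof.
have fundK : stationary_vector *m fund = ones by rewrite mulmxKV // fund_unit.
move: fundK; rewrite mulmxDr mulmxBr mulmx1 mulmxA row_mul_one.
rewrite stationary_vector_sum mul1mx => /(canRL (addrK _)); rewrite subrr => /eqP.
by rewrite subr_eq0 => /eqP <-.
Qed.

Lemma stationary_vector_unique v :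
  v *m Q = v -> \sum_k v 0 k = 1 -> v = stationary_vector.
Proof.
move=> vQ v1; have := fixed_proportional vQ stationary_vector_fixed.
by rewrite v1 stationary_vector_sum !scale1r.
Qed.

(** The row |v| is also fixed, hence proportional to v, with a positive
    factor. *)
Lemma fixed_ge0 v k : v *m Q = v -> \sum_k v 0 k = 1 -> 0 <= v 0 k.
Proof.
move=> vQ v1; have := fixed_proportional vQ (fixed_abs vQ).
rewrite v1 scale1r => /matrixP/(_ 0 k).
set t := \sum_k _; rewrite !mxE => tE.
have t_ge1 : 1 <= t.
  by rewrite -v1; apply: ler_sum => j _; rewrite mxE ler_norm.
by rewrite -(pmulr_rge0 _ (lt_le_trans ltr01 t_ge1)) tE.
Qed.

(** The Fredholm alternative for 1 - Q: being orthogonal to the stationary row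
    is the only obstruction. *)
Lemma poisson_solvable v b : v *m Q = v -> \sum_k v 0 k = 1 ->
  v *m b = 0 -> exists h, h - Q *m h = b.
Proof.
move=> vQ v1 vb; pose h := invmx fund *m b; exists h.
have fundh : fund *m h = b by rewrite mulKVmx // fund_unit.
have onesE : v *m fund = ones by rewrite fixed_fund // v1 scale1r.
have onesh : ones *m h = 0 by rewrite -onesE -mulmxA fundh.
by move: fundh; rewrite mulmxDl mulmxBl mul1mx -mulmxA onesh mulmx0 addr0.
Qed.

End IrreducibleStochastic.

(** * A strong law for martingales of finite chains *)

(** A sequence with bounded increments moves by at most 15 C k^3 between k^4 and
    (k+1)^4, which is negligible against k^4; it therefore suffices to control
    it along fourth powers. *)
Lemma cvg_average_fourth_powers (R : realType) (m : nat -> R) (C : R) (k0 : nat) :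
  (forall n, `|m n.+1 - m n| <= C) ->
  (forall k, (k0 <= k)%N -> `|m (k ^ 4)%N| <= k%:R ^+ 3) ->
  (fun n : nat => n%:R^-1 * m n) @ \oo --> (0 : R).
Proof.
move=> dm mk; have C0 : 0 <= C by rewrite (le_trans _ (dm 0%N)).
have lip n j : `|m (n + j)%N - m n| <= C * j%:R.
  elim: j => [|j IHj]; first by rewrite addn0 subrr normr0 mulr0.
  rewrite -natr1 mulrDr mulr1 addnS (le_trans (ler_distD (m (n + j)%N) _ _)) //.
  by rewrite addrC lerD.
apply/cvgrPdist_le => e e0; pose B := 1 + 15 * C.
have B0 : 0 <= B by rewrite addr_ge0 ?mulr_ge0.
(* k1 is large enough for the control to hold and for B / k1 <= e. *)
pose k1 := (maxn k0 (Num.bound (B / e))).+1.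
have k1B : B <= e * k1%:R.
  rewrite -ler_pdivrMl // mulrC.
  have Be : 0 <= B / e by rewrite divr_ge0 // ltW.
  rewrite (le_trans (ltW (archi_boundP Be))) // ler_nat.
  by rewrite (leq_trans (leq_maxr k0 _)) // leqnSn.
exists (k1 ^ 4)%N => // n /= k1n.
have ubn k : (k ^ 4 <= n)%N -> (k <= n)%N.
  by apply: leq_trans; case: k => // k; rewrite -{1}[k.+1]expn1 leq_pexp2l.
case: (ex_maxnP (ex_intro (fun k => k ^ 4 <= n)%N k1 k1n) ubn) => k kn kmax.
have k1k : (k1 <= k)%N by exact: kmax.
have nk : (n < k.+1 ^ 4)%N.
  by rewrite ltnNge; apply/negP => /kmax; rewrite ltnn.
have k_gt0 : (0 < k)%N by exact: leq_trans k1k.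
have gap : (n - k ^ 4 <= 15 * k ^ 3)%N by nia.
have n_gt0 : (0 < n)%N by rewrite (leq_trans _ kn) // expn_gt0 k_gt0.
have mn : `|m n| <= B * k%:R ^+ 3.
  rewrite -(subnKC kn) -(subrK (m (k ^ 4)%N) (m _)) (le_trans (ler_normD _ _)) //.
  rewrite /B mulrDl mul1r addrC lerD //.
    by rewrite mk // (leq_trans _ k1k) // ltnW // ltnS leq_maxl.
  rewrite (le_trans (lip _ _)) // -mulrA mulrCA ler_wpM2l //.
  by rewrite -natrX -natrM ler_nat.
rewrite sub0r normrN normrM normfV (ger0_norm (ler0n _ _)).
rewrite ler_pdivrMl ?ltr0n // (le_trans mn) // mulrC.
rewrite (@le_trans _ _ (k%:R ^+ 3 * (e * k%:R))) //.
  rewrite ler_wpM2l ?exprn_ge0 // (le_trans k1B) // ler_wpM2l ?(ltW e0) //.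
  by rewrite ler_nat.
by rewrite mulrCA -exprSr [leRHS]mulrC ler_wpM2l ?(ltW e0) // -natrX ler_nat.
Qed.

(** The terms are dominated by those of the telescoping sum of
    1/(k+1) - 1/(k+2). *)
Lemma sum_inv_squares_le1 (R : realFieldType) n :
  \sum_(0 <= k < n) (k.+2%:R ^- 2 : R) <= 1.
Proof.
suff le1 : \sum_(0 <= k < n) (k.+2%:R ^- 2 : R) <= 1 - n.+1%:R^-1.
  by rewrite (le_trans le1) // gerBl invr_ge0.
elim: n => [|n IHn]; first by rewrite big_nil invr1 subrr.
rewrite big_nat_recr //= -[leRHS](subrKA n.+1%:R^-1) lerD //.
rewrite lerBrDr; set a := n.+1%:R : R.
have a0 : 0 < a by rewrite ltr0n.
have -> : n.+2%:R = a + 1 :> R by rewrite /a natr1.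
have a1 : 0 < a + 1 by rewrite addr_gt0.
rewrite -[leRHS]mul1r ler_pdivlMr //.
have -> : ((a + 1) ^- 2 + (a + 1)^-1) * a = (a ^+ 2 + 2 * a) / (a + 1) ^+ 2.
  by field; rewrite gt_eqF.
by rewrite ler_pdivrMr ?exprn_gt0 //; nra.
Qed.

Section FiniteValued.
Variables (R : realType) (d : measure_display) (T : measurableType d).
Variables (P : probability T R) (F : finType) (V : T -> F).
Hypothesis mV : forall f, measurable [set t | V t = f].

Lemma finite_fibers (A : pred F) : measurable [set t | A (V t)] /\
  fine (P [set t | A (V t)]) = \sum_(f | A f) fine (P [set t | V t = f]).
Proof.
have seqP (s : seq F) : uniq s -> measurable [set t | V t \in s] /\
    fine (P [set t | V t \in s]) = \sum_(f <- s) fine (P [set t | V t = f]).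
  elim: s => [_|f s IHs /= /andP[fs /IHs[ms Ps]]].
    rewrite big_nil (_ : [set _ | _] = set0) ?measure0; last by apply/seteqP; split.
    by split; first exact: measurable0.
  rewrite (_ : [set _ | _] = [set t | V t = f] `|` [set t | V t \in s]); last first.
    apply/seteqP; split=> t /=; rewrite inE; first by case/orP => [/eqP|]; tauto.
    by case=> [->|->]; rewrite ?eqxx ?orbT.
  split; first exact: measurableU.
  rewrite measureU //; last first.
    by apply/seteqP; split=> t //= [->]; rewrite (negPf fs).
  by rewrite fineD ?fin_num_measure // big_cons Ps.
have [] := seqP (enum A) (enum_uniq _); rewrite big_enum /=.
by rewrite (_ : [set t | _] = [set t | A (V t)]) //; apply/seteqP; split=> t /=;
  rewrite mem_enum.
Qed.

End FiniteValued.

Section MartingaleStrongLaw.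
Variables (R : realType) (d : measure_display) (T : measurableType d).
Variables (P : probability T R) (E : finType).
Variables (Z : nat -> T -> E) (K phi : nat -> E -> E -> R) (C : R).
Hypothesis Zchain : markov_chain P Z K.
Hypothesis K_ge0 : forall n a b, 0 <= K n a b.
Hypothesis K_sum1 : forall n a, \sum_b K n a b = 1.
Hypothesis phi_centered : forall n a, \sum_b K n a b * phi n a b = 0.
Hypothesis phi_bounded : forall n a b, `|phi n a b| <= C.

(** The whole trajectory up to time n, as an iterated product: sums over
    trajectories of length n.+1 then split as iterated sums, and every
    expectation below is a finite sum weighted by prob. *)
Fixpoint history (n : nat) : finType :=
  if n is m.+1 then (history m * E)%type : finType else E.

Definition current n : history n -> E :=
  match n with 0%N => id | m.+1 => snd end.

Fixpoint observed n t : history n :=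
  match n with 0%N => Z 0%N t | m.+1 => (observed m t, Z m.+1 t) end.

Fixpoint mart n : history n -> R :=
  match n with
  | 0%N => fun=> 0
  | m.+1 => fun w => mart w.1 + phi m (current w.1) w.2
  end.

Lemma current_observed n t : current (observed n t) = Z n t.
Proof. by case: n. Qed.

Lemma mart_observed n t :
  mart (observed n t) = \sum_(0 <= k < n) phi k (Z k t) (Z k.+1 t).
Proof.
elim: n => [|n IHn] /=; first by rewrite big_nil.
by rewrite big_nat_recr //= IHn current_observed.
Qed.

(** The Markov property is stated for trajectories given as functions on nat;
    this translates from the product encoding. *)
Lemma history_event n (w : history n) : exists2 e : nat -> E, e n = current w &
  [set t | observed n t = w] =
  [set t | forall k, (k <= n)%N -> Z k t = e k].
Proof.
elim: n w => [|n IHn] w.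
  exists (fun=> w) => //; apply/seteqP; split=> t /=; last exact.
  by move=> Zw k; rewrite leqn0 => /eqP->.
case: w => w b; have [e _ we] := IHn w.
exists (fun k => if k == n.+1 then b else e k); first by rewrite eqxx.
apply/seteqP; split=> t /=.
  case=> tw tb k; case: eqP => [-> //|/eqP kn kn1].
  have : [set t | observed n t = w] t by [].
  by rewrite we; apply; rewrite -ltnS ltn_neqAle kn.
move=> te; have <- : Z n.+1 t = b by rewrite te ?eqxx.
congr (_, _); suff : [set t | observed n t = w] t by [].
by rewrite we => k kn; rewrite te ?(leqW kn) // ltn_eqF.
Qed.

Lemma measurable_observed n (w : history n) :
  measurable [set t | observed n t = w].
Proof.
elim: n w => [|n IHn] w; first exact: (proj1 Zchain).
have -> : [set t | observed n.+1 t = w] =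
    [set t | observed n t = w.1] `&` [set t | Z n.+1 t = w.2].
  by case: w => w b; apply/seteqP; split=> t /= [-> ->].
by apply: measurableI => //; exact: (proj1 Zchain).
Qed.

Definition prob n (w : history n) : R := fine (P [set t | observed n t = w]).

Lemma prob_ge0 n (w : history n) : 0 <= prob w.
Proof. exact: fine_ge0. Qed.

Lemma prob_step n (w : history n) b :
  prob ((w, b) : history n.+1) = prob w * K n (current w) b.
Proof.
rewrite /prob; have -> : [set t | observed n.+1 t = (w, b)] =
    [set t | Z n.+1 t = b] `&` [set t | observed n t = w].
  by apply/seteqP; split=> t /= [-> ->].
have mw := measurable_observed w; have mb := proj1 Zchain n.+1 b.
have [e en we] := history_event w.
have := proj2 Zchain n e b; rewrite /= -we en /cond_prob.
have [P0|P_neq0 /(_ isT)] := eqVneq (P [set t | observed n t = w]) 0%E.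
  (* On a null history the Markov property says nothing, but both sides vanish. *)
  move=> _; rewrite P0 mul0r; apply/eqP; rewrite fine_eq0 ?fin_num_measure //.
    by rewrite eq_le measure_ge0 andbT -P0 le_measure ?inE //; exact: measurableI.
  exact: measurableI.
move=> <-; rewrite mulrC divfK // fine_eq0 ?fin_num_measure //.
Qed.

Lemma prob_sum1 n : \sum_(w : history n) prob w = 1.
Proof.
have [_] := finite_fibers P (@measurable_observed n) xpredT.
by rewrite (_ : [set t | _] = setT) ?probability_setT //; apply/seteqP; split.
Qed.

(** Orthogonality of martingale increments: conditionally on a history the cross
    term vanishes by phi_centered, so each step adds at most C^2. *)
Lemma mart_variance n :
  \sum_(w : history n) prob w * mart w ^+ 2 <= C ^+ 2 * n%:R.
Proof.
elim: n => [|n IHn].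
  by rewrite mulr0 big1 // => w _; rewrite expr0n mulr0.
have -> : \sum_(w : history n.+1) prob w * mart w ^+ 2 =
    \sum_(w : history n) \sum_b prob ((w, b) : history n.+1) *
      (mart w + phi n (current w) b) ^+ 2.
  by rewrite pair_bigA; apply: eq_bigr => -[].
have C2 : \sum_(w : history n) C ^+ 2 * prob w = C ^+ 2.
  by rewrite -mulr_sumr prob_sum1 mulr1.
rewrite -natr1 mulrDr mulr1 -[X in _ <= _ + X]C2.
rewrite (le_trans _ (lerD IHn (lexx _))) // -big_split /=.
apply: ler_sum => w _; rewrite [C ^+ 2 * _]mulrC -mulrDr.
under eq_bigr do rewrite prob_step -mulrA.
rewrite -mulr_sumr ler_wpM2l ?prob_ge0 //.
set a := current w.
have -> : \sum_b K n a b * (mart w + phi n a b) ^+ 2 =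
    mart w ^+ 2 + \sum_b K n a b * phi n a b ^+ 2.
  under eq_bigr => b _.
    have -> : K n a b * (mart w + phi n a b) ^+ 2 = K n a b * mart w ^+ 2 +
      2 * mart w * (K n a b * phi n a b) + K n a b * phi n a b ^+ 2 by ring.
    over.
  by rewrite !big_split /= -mulr_suml K_sum1 mul1r -mulr_sumr phi_centered mulr0 addr0.
rewrite lerD2l -[leRHS]mulr1 -(K_sum1 n a) mulr_sumr; apply: ler_sum => b _.
rewrite mulrC ler_wpM2r // -(real_normK (num_real (phi n a b))) lerXn2r //.
by rewrite nnegrE (le_trans _ (phi_bounded n a b)).
Qed.

(** Chebyshev's inequality. *)
Lemma mart_tail n (a : R) : 0 < a ->
  fine (P [set t | a <= `|mart (observed n t)|]) <= C ^+ 2 * n%:R / a ^+ 2.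
Proof.
move=> a0; rewrite ler_pdivlMr ?exprn_gt0 // (le_trans _ (mart_variance n)) //.
have [_ ->] := finite_fibers P (@measurable_observed n) (fun w => a <= `|mart w|).
rewrite mulr_suml big_mkcond; apply: ler_sum => w _.
case: ifP => [aw|_]; last by rewrite mulr_ge0 ?prob_ge0 ?sqr_ge0.
rewrite ler_wpM2l ?prob_ge0 // -[mart w ^+ 2]ger0_norm ?sqr_ge0 // normrX.
by rewrite lerXn2r ?nnegrE // ltW.
Qed.

(** At time k^4 the event |mart| >= k^3 has probability at most
    C^2 k^4 / k^6 = C^2 / k^2, which is summable; by Borel-Cantelli almost every
    trajectory eventually satisfies the bound |mart| < k^3 that
    [cvg_average_fourth_powers] asks for. *)
Theorem martingale_strong_law : {ae P, forall t,
  (fun n : nat => n%:R^-1 * \sum_(0 <= k < n) phi k (Z k t) (Z k.+1 t)) @ \oo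
    --> (0 : R)}.
Proof.
pose A k := [set t | k.+2%:R ^+ 3 <= `|mart (observed (k.+2 ^ 4) t)|].
have mA k : measurable (A k).
  exact: (proj1 (finite_fibers P (@measurable_observed _)
    (fun w => k.+2%:R ^+ 3 <= `|mart w|))).
have PA k : (P (A k) <= (C ^+ 2 * k.+2%:R ^- 2)%:E)%E.
  rewrite -[P _]fineK ?fin_num_measure // lee_fin.
  have k0 : 0 < k.+2%:R :> R by rewrite ltr0n.
  rewrite (le_trans (mart_tail _ (exprn_gt0 3 k0))) // natrX.
  move: (k.+2%:R) k0 => x x0; rewrite le_eqVlt; apply/orP; left; apply/eqP.
  by field; rewrite gt_eqF.
exists (lim_sup_set A); split.
- by apply: bigcap_measurable => // n _; exact: bigcup_measurable.
- apply: lim_sup_set_cvg0 => //.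
  rewrite (@le_lt_trans _ _ (C ^+ 2)%:E) ?ltry //.
  apply: lime_le; first exact: is_cvg_nneseries.
  apply: nearW => n; rewrite (le_trans (lee_sum _ (fun k _ => PA k))) //.
  rewrite sumEFin lee_fin -mulr_sumr -[leRHS]mulr1 ler_wpM2l ?sqr_ge0 //.
  exact: sum_inv_squares_le1.
- move=> t /= ncvg; apply: contrapT => nA; apply: ncvg.
  have [k0 k0A] : exists k0, forall k, (k0 <= k)%N -> ~ A k t.
    apply: contrapT => nk0; apply: nA => k0 _; apply: contrapT => nk.
    by apply: nk0; exists k0 => k kk0 Akt; apply: nk; exists k.
  under eq_fun do rewrite -mart_observed.
  apply: (@cvg_average_fourth_powers _ _ C k0.+2) => [n|[|[|k]] // k0k].
    by rewrite /= addrAC subrr add0r.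
  by apply: ltW; rewrite ltNge; apply/negP; exact: k0A.
Qed.

End MartingaleStrongLaw.

Lemma cvg_bounded_average (R : realType) (u : nat -> R) (C : R) :
  (forall n, `|u n| <= C) -> (fun n : nat => n%:R^-1 * u n) @ \oo --> (0 : R).
Proof.
move=> uC; have C0 : 0 <= C by rewrite (le_trans _ (uC 0%N)).
apply/cvgrPdist_le => e e0; have Ce : 0 <= C / e by rewrite divr_ge0 // ltW.
exists (Num.bound (C / e)).+1 => // n /= ne.
have n0 : (0 < n)%N by exact: leq_ltn_trans ne.
rewrite sub0r normrN normrM normfV (ger0_norm (ler0n _ _)) ler_pdivrMl ?ltr0n //.
rewrite (le_trans (uC n)) // -ler_pdivrMr // (le_trans (ltW (archi_boundP Ce))) //.
by rewrite ler_nat ltnW.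
Qed.

(** When H solves the time-dependent Poisson equation for the payoff f, the
    quantity f(Z_n, Z_(n+1)) - mu + H_(n+1)(Z_(n+1)) - H_n(Z_n) is a bounded
    martingale increment, and the terms in H telescope to a bounded sequence. *)
Theorem poisson_strong_law (R : realType) (d : measure_display)
    (T : measurableType d) (P : probability T R) (E : finType)
    (Z : nat -> T -> E) (K : nat -> E -> E -> R) (f : E -> E -> R)
    (H : nat -> E -> R) (mu Cf CH : R) :
  markov_chain P Z K ->
  (forall n a b, 0 <= K n a b) -> (forall n a, \sum_b K n a b = 1) ->
  (forall a b, `|f a b| <= Cf) -> (forall n a, `|H n a| <= CH) ->
  (forall n a, \sum_b K n a b * (f a b + H n.+1 b) = mu + H n a) ->
  {ae P, forall t,
    (fun n : nat => n%:R^-1 * \sum_(0 <= k < n) f (Z k t) (Z k.+1 t)) @ \oo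
      --> mu}.
Proof.
move=> Zchain K0 K1 fC HC poisson.
pose phi n a b := f a b + H n.+1 b - (mu + H n a).
have phi0 n a : \sum_b K n a b * phi n a b = 0.
  under eq_bigr do rewrite mulrBr.
  by rewrite sumrB -mulr_suml K1 mul1r poisson subrr.
have phiC n a b : `|phi n a b| <= Cf + CH + (`|mu| + CH).
  by rewrite (le_trans (ler_normB _ _)) // lerD // (le_trans (ler_normD _ _)) // lerD.
have := martingale_strong_law Zchain K0 K1 phi0 phiC.
apply: filterS => t /= lim_phi.
have lim_H : (fun n : nat => n%:R^-1 * (H 0%N (Z 0%N t) - H n (Z n t))) @ \oo
    --> (0 : R).
  apply: (@cvg_bounded_average _ _ (CH + CH)) => n.
  by rewrite (le_trans (ler_normB _ _)) // lerD.
have lim_sum : (fun n : nat =>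
    n%:R^-1 * \sum_(0 <= k < n) phi k (Z k t) (Z k.+1 t) +
    n%:R^-1 * (H 0%N (Z 0%N t) - H n (Z n t)) + mu) @ \oo --> 0 + 0 + mu.
  by apply: cvgD; [exact: cvgD | exact: cvg_cst].
rewrite !add0r in lim_sum.
move: lim_sum; apply: cvg_trans; apply: near_eq_cvg; exists 1%N => // n /= n1.
have n0 : n%:R != 0 :> R by rewrite pnatr_eq0 -lt0n.
have -> : \sum_(0 <= k < n) phi k (Z k t) (Z k.+1 t) =
    \sum_(0 <= k < n) f (Z k t) (Z k.+1 t) - n%:R * mu
    + (H n (Z n t) - H 0%N (Z 0%N t)).
  rewrite -(telescope_sumr (fun k => H k (Z k t))) //.
  have -> : n%:R * mu = \sum_(0 <= k < n) mu.
    by rewrite sumr_const_nat subn0 mulr_natl.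
  by rewrite -sumrB -big_split; apply: eq_bigr => k _; rewrite /phi /=; ring.
by field.
Qed.

(** * Periodic Poisson equations *)

Lemma modnS_mod (n c : nat) : (n.+1 %% c = (n %% c).+1 %% c)%N.
Proof. by rewrite -[n.+1]addn1 -modnDml addn1. Qed.

(** The recursion runs from the end of the period, so phase j is reached after
    c - j steps; the hypothesis lets consecutive periods be glued together. *)
Lemma periodic_backward_orbit (H : Type) (c : nat) (step : nat -> H -> H)
    (h0 : H) : (0 < c)%N ->
  iteri c (fun k => step (c - k.+1)%N) h0 = h0 ->
  exists2 h : nat -> H, forall n, h n = step (n %% c)%N (h n.+1) &
    forall n, h n = h (n %% c)%N.
Proof.
move=> c0; pose back k := iteri k (fun k => step (c - k.+1)%N) h0.
rewrite -/(back c) => back_c.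
exists (fun n => back (c - n %% c)%N) => n; last by rewrite modn_mod.
have := ltn_pmod n c0; set j := (n %% c)%N => jc.
have -> : (c - j = (c - j.+1).+1)%N by rewrite subnSK.
rewrite [LHS]iteriS -/(back _).
have -> : (c - (c - j.+1).+1 = j)%N by rewrite subnSK // subKn // ltnW.
congr (step _ _); rewrite modnS_mod -/j.
(* At the end of a period the next phase is 0, and back c = back 0 closes up. *)
move: jc; rewrite leq_eqVlt => /orP[/eqP->|jc]; last by rewrite modn_small.
by rewrite modnn subn0 subnn back_c.
Qed.

Lemma periodic_bounded (R : realType) (E : finType) (c : nat)
    (h : nat -> E -> R) : (0 < c)%N -> (forall n, h n = h (n %% c)%N) ->
  exists C, forall n a, `|h n a| <= C.
Proof.
move=> c0 hper; exists (\sum_(j < c) \sum_a `|h j a|) => n a.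
rewrite hper (bigD1 (Ordinal (ltn_pmod n c0))) //= (bigD1 a) //= -addrA.
by rewrite lerDl addr_ge0 ?sumr_ge0 // => *; rewrite ?sumr_ge0.
Qed.

(** Running the affine recursion h_k = g_k - mu + P_k h_(k+1) backward over one
    period sends h0 to Q h0 + b, where b collects the payoffs of the s rounds of
    B minus (r + s) mu. A periodic solution is thus a solution of h0 - Q h0 = b,
    and the value of mu is exactly what makes b orthogonal to pi. *)
Lemma periodic_poisson (R : realFieldType) (n : nat) (i0 : 'I_n)
    (A B : 'M[R]_n) (g : 'cV[R]_n) (pi : 'rV[R]_n) (r s : nat) (mu : R) :
  (0 < r + s)%N -> stochastic A -> stochastic B ->
  irreducible (A ^+ r *m B ^+ s) -> pi *m (A ^+ r *m B ^+ s) = pi ->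
  \sum_k pi 0 k = 1 ->
  mu = (r + s)%:R^-1 * \sum_(0 <= v < s)
    (pi *m A ^+ r *m B ^+ v *m g) 0 0 ->
  exists2 h : nat -> 'cV[R]_n,
    forall k, h k = (if (k %% (r + s) < r)%N then A *m h k.+1
                     else g + B *m h k.+1) - const_mx mu &
    forall k, h k = h (k %% (r + s))%N.
Proof.
set c := (r + s)%N; set Q := A ^+ r *m B ^+ s.
move=> c0 As Bs Qi piQ pi1 muE; have Qs : stochastic Q.
  by apply: stochasticM; exact: stochasticX.
pose b : 'cV_n := \sum_(0 <= v < s) A ^+ r *m (B ^+ v *m g) - const_mx (c%:R * mu).
have const_scale (M : 'M[R]_n) x : stochastic M ->
    M *m const_mx x = const_mx x :> 'cV_n.
  move=> [_ M1]; have -> : const_mx x = x *: const_mx 1 :> 'cV[R]_n.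
    by apply/matrixP => i j; rewrite !mxE mulr1.
  by rewrite -scalemxAr M1.
have pib : pi *m b = 0.
  apply/matrixP => i j; rewrite !ord1 mulmxBr mulmx_sumr.
  rewrite 2!mxE summxE [X in _ - X]mxE.
  under [X in _ - X]eq_bigr do rewrite mxE.
  rewrite -mulr_suml pi1 mul1r muE mulrA.
  rewrite mulfV ?mul1r ?pnatr_eq0 -?lt0n // [RHS]mxE.
  by apply/eqP; rewrite subr_eq0; apply/eqP; apply: eq_bigr => v _; rewrite !mulmxA.
have [h0 h0E] := poisson_solvable i0 Qs Qi piQ pi1 pib.
pose step j h := (if (j < r)%N then A *m h else g + B *m h) - const_mx mu : 'cV_n.
pose back k := iteri k (fun k => step (c - k.+1)%N) h0.
(* Phases are visited in decreasing order, so the rounds of B come first. *)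
have backB k : (k <= s)%N -> back k = B ^+ k *m h0 +
    \sum_(0 <= v < k) B ^+ v *m g - const_mx (k%:R * mu).
  elim: k => [_|k IHk ks].
    rewrite big_nil addr0 expr0 mul0r [X in X *m _]/(1%:M) mul1mx.
    by apply/matrixP => i j; rewrite !mxE subr0.
  rewrite /back iteriS -/(back k) IHk ?(ltnW ks) // /step ifF; last first.
    by apply/negbTE; rewrite -leqNgt /c -addnBA // leq_addr.
  rewrite mulmxBr mulmxDr const_scale // mulmxA mulmx_sumr big_nat_recl //.
  rewrite expr0 [X in X *m g]/(1%:M) mul1mx.
  have -> : const_mx (k.+1%:R * mu) = const_mx (k%:R * mu) + const_mx mu :> 'cV[R]_n.
    by apply/matrixP => i j; rewrite !mxE -natr1 mulrDl mul1r.
  under [in LHS]eq_bigr do rewrite mulmxA.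
  under [in RHS]eq_bigr do rewrite exprS.
  by rewrite opprD !addrA exprS [g + _]addrC.
have backA k : (k <= r)%N ->
    back (s + k)%N = A ^+ k *m back s - const_mx (k%:R * mu).
  elim: k => [_|k IHk kr].
    rewrite addn0 expr0 mul0r [X in X *m _]/(1%:M) mul1mx.
    by apply/matrixP => i j; rewrite !mxE subr0.
  rewrite addnS {1}/back iteriS -/(back _) IHk ?(ltnW kr) // /step ifT; last first.
    by rewrite /c; lia.
  rewrite mulmxBr const_scale // mulmxA exprS -addrA -opprD; congr (_ - _).
  by apply/matrixP => i j; rewrite !mxE -natr1 mulrDl mul1r.
have back_c : back c = h0.
  rewrite /c addnC backA // backB // mulmxBr mulmxDr const_scale; last first.
    exact: stochasticX.
  rewrite mulmxA -/Q mulmx_sumr -[RHS](subrK (Q *m h0)) h0E /b /c.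
  rewrite natrD mulrDl [RHS]addrC -!addrA -opprD; congr (_ + (_ - _)).
  by apply/matrixP => i j; rewrite !mxE addrC.
have [h hE hper] := periodic_backward_orbit c0 back_c.
by exists h.
Qed.

(** * The random walks on configurations *)

Section WalkSums.
Variables (R : realType) (N : nat).
Implicit Types (p q : 'I_4 -> R) (x y : config N) (i : 'I_N).

Lemma flip_neq x i : (flip x i == x) = false.
Proof.
by apply/eqP => /ffunP/(_ i); rewrite ffunE eqxx; case: (x i).
Qed.

(** The action of the random walk on functions, as an average over the player
    chosen; it frees what follows from the case analysis in walk_mx. *)
Lemma walk_mx_mul p q x (F : config N -> R) :
  \sum_y walk_mx p q x y * F y = N%:R^-1 * \sum_i
    (if x i then q (nbhd x i) * F (flip x i) + p (nbhd x i) * F x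
     else p (nbhd x i) * F (flip x i) + q (nbhd x i) * F x).
Proof.
rewrite (bigD1 x) //= {1}/walk_mx eqxx.
have -> : \sum_(y | y != x) walk_mx p q x y * F y =
    \sum_i N%:R^-1 * (if x i then q (nbhd x i) else p (nbhd x i)) * F (flip x i).
  under eq_bigr => y /negPf yx do rewrite /walk_mx yx mulr_suml.
  rewrite (exchange_big_dep xpredT) //=; apply: eq_bigr => i _.
  rewrite (big_pred1 (flip x i)) // => y /=.
  by case: (eqVneq y (flip x i)) => [->|_]; rewrite ?flip_neq ?andbF.
rewrite mulrDr mulrDl -!mulrA !mulr_suml !mulr_sumr big_mkcond [X in _ + X + _]big_mkcond.
rewrite -!big_split; apply: eq_bigr => i _ /=.
by case: (x i) => /=; ring.
Qed.

Definition flip_prob p x i : R :=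
  if x i then 1 - p (nbhd x i) else p (nbhd x i).

(** The next label is uniform and independent of the next configuration, so only
    the average of F over labels matters; averaging this over i as well gives
    [P_B_mul]. *)
Lemma Pstar_mul p x i (F : config N * 'I_N -> R) :
  \sum_b Pstar_B p (x, i) b * F b =
  flip_prob p x i * (N%:R^-1 * \sum_j F (flip x i, j)) +
  (1 - flip_prob p x i) * (N%:R^-1 * \sum_j F (x, j)).
Proof.
transitivity (\sum_y \sum_j Pstar_B p (x, i) (y, j) * F (y, j)).
  by rewrite pair_bigA; apply: eq_bigr => -[].
rewrite (bigD1 x) //= (bigD1 (flip x i)) ?flip_neq //=.
rewrite [X in _ + (_ + X)]big1; last first.
  by move=> y /andP[/negPf yx /negPf yf]; rewrite big1 // => j _; rewrite yx yf mul0r.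
rewrite addr0 addrC eqxx eq_sym flip_neq /flip_prob; congr (_ + _).
  by rewrite -mulr_sumr; case: ifP => _; ring.
by rewrite -mulr_sumr eqxx; case: ifP => _; ring.
Qed.

Lemma P_B_mul p x (F : config N -> R) : \sum_y P_B p x y * F y =
  N%:R^-1 * \sum_i
    (flip_prob p x i * F (flip x i) + (1 - flip_prob p x i) * F x).
Proof.
rewrite walk_mx_mul; congr (_ * _); apply: eq_bigr => i _.
by rewrite /flip_prob; case: (x i) => //; rewrite subKr.
Qed.

Lemma Pdot_B_sum p x : \sum_y Pdot_B p x y =
  N%:R^-1 * \sum_i (2 * p (nbhd x i) - 1).
Proof.
under eq_bigr do rewrite -[Pdot_B _ _ _]mulr1.
rewrite (walk_mx_mul p (fun m => - (1 - p m)) x (fun=> 1)).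
by congr (_ * _); apply: eq_bigr => i _; case: (x i); ring.
Qed.

Hypothesis N_gt0 : (0 < N)%N.

Lemma avg_const (c : R) : N%:R^-1 * \sum_(i < N) c = c.
Proof.
by rewrite sumr_const card_ord -[c *+ N]mulr_natr mulrCA mulVf ?mulr1 // pnatr_eq0 -lt0n.
Qed.

Lemma P_B_sum1 p x : \sum_y P_B p x y = 1.
Proof.
under eq_bigr do rewrite -[P_B _ _ _]mulr1.
rewrite (P_B_mul p x (fun=> 1)) -[RHS]avg_const; congr (_ * _).
by apply: eq_bigr => i _; ring.
Qed.

Lemma Pstar_sum1 p (a : config N * 'I_N) : \sum_b Pstar_B p a b = 1.
Proof.
case: a => x i; under eq_bigr do rewrite -[Pstar_B _ _ _]mulr1.
by rewrite (Pstar_mul p x i (fun=> 1)) !avg_const; ring.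
Qed.

Lemma Pstar_payoff p x i :
  \sum_b Pstar_B p (x, i) b * payoff R (x, i) b = 2 * p (nbhd x i) - 1.
Proof.
rewrite Pstar_mul /= (eq_sym x) !flip_neq !eqxx !avg_const /flip_prob.
by case: (x i); ring.
Qed.

Variable p : 'I_4 -> R.
Hypothesis p01 : forall m, 0 < p m < 1.

Lemma flip_prob_itv x i : 0 < flip_prob p x i < 1.
Proof.
by rewrite /flip_prob; case: (x i); have /andP[? ?] := p01 (nbhd x i); lra.
Qed.

Lemma Pstar_ge0 (a b : config N * 'I_N) : 0 <= Pstar_B p a b.
Proof.
case: a b => x i [y j] /=; have /andP[] := p01 (nbhd x i) => p0 p1.
case: ifP => _; last (case: ifP => _ //);
by rewrite mulr_ge0 ?invr_ge0 //; case: ifP => _; lra.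
Qed.

Lemma P_B_entry x z : P_B p x z = N%:R^-1 * \sum_i
  (flip_prob p x i * (flip x i == z)%:R + (1 - flip_prob p x i) * (x == z)%:R).
Proof.
have -> : P_B p x z = \sum_y P_B p x y * (y == z)%:R.
  rewrite (bigD1 z) //= eqxx mulr1 big1 ?addr0 // => y /negPf->.
  by rewrite mulr0.
by rewrite P_B_mul.
Qed.

Let entry_ge0 x z i : 0 <=
  flip_prob p x i * (flip x i == z)%:R + (1 - flip_prob p x i) * (x == z)%:R.
Proof.
have /andP[f0 f1] := flip_prob_itv x i.
by rewrite addr_ge0 // mulr_ge0 // ?subr_ge0 ltW.
Qed.

Lemma P_B_ge0 x z : 0 <= P_B p x z.
Proof. by rewrite P_B_entry mulr_ge0 ?invr_ge0 // sumr_ge0. Qed.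

Lemma P_B_gt0 x z i : z = flip x i \/ z = x -> 0 < P_B p x z.
Proof.
move=> zE; rewrite P_B_entry mulr_gt0 ?invr_gt0 ?ltr0n //.
rewrite (bigD1 i) //= ltr_wpDr ?sumr_ge0 //.
have /andP[f0 f1] := flip_prob_itv x i.
case: zE => ->; rewrite eqxx mulr1 ?flip_neq ?(eq_sym x) ?flip_neq mulr0.
  by rewrite addr0.
by rewrite add0r subr_gt0.
Qed.

End WalkSums.

(** * Passing to orbits *)

Section Lumping.
Variables (R : realType) (N : nat) (G : {group {perm 'I_N}}).
Implicit Types (x y : config N) (M : config N -> config N -> R).

Lemma pblock_orbits x : finset.pblock (orbits G) x \in orbits G.
Proof.
apply: finset.pblock_mem.
have /and3P[/eqP-> _ _] := equivalence_partitionP (@sim_equiv _ G).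
by rewrite inE.
Qed.

Definition orbit_index x : 'I_#|orbits G| :=
  enum_rank_in (pblock_orbits x) (finset.pblock (orbits G) x).

Lemma mem_orbit_val x j : (x \in orbit_val j) = (orbit_index x == j).
Proof.
have /and3P[/eqP cov triv _] := equivalence_partitionP (@sim_equiv _ G).
have jin : orbit_val j \in orbits G by exact: enum_valP.
apply/idP/eqP => [xj|<-].
  apply: enum_val_inj; rewrite enum_rankK_in ?pblock_orbits //.
  exact: finset.def_pblock xj.
by rewrite /orbit_val enum_rankK_in ?pblock_orbits // finset.mem_pblock cov inE.
Qed.

Lemma orbit_index_surj j : exists x, orbit_index x = j.
Proof.
have /and3P[_ _ n0] := equivalence_partitionP (@sim_equiv _ G).
have : orbit_val j != finset.set0 by apply: contraNneq n0 => <-; exact: enum_valP.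
by case/set0Pn => x; rewrite mem_orbit_val => /eqP; exists x.
Qed.

Variable M : config N -> config N -> R.
Hypothesis Minv : invariant_mx G M.

(** Functions on orbits are the functions of configurations that factor through
    orbit_index, and the quotient matrix is the restriction of M to them. *)
Lemma quot_mx_mul (h : 'cV[R]_#|orbits G|) x :
  (quot_mx G M *m h) (orbit_index x) 0 = \sum_y M x y * h (orbit_index y) 0.
Proof.
rewrite mxE (partition_big orbit_index xpredT) //=; apply: eq_bigr => j _.
rewrite (quot_mxE _ Minv (x := x)) ?mem_orbit_val // mulr_suml.
by apply: eq_big => y; rewrite mem_orbit_val // => /eqP->.
Qed.

Hypothesis M_ge0 : forall x y, 0 <= M x y.

Lemma quot_mx_ge0 i j : 0 <= quot_mx G M i j.
Proof. by rewrite mxE sumr_ge0. Qed.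

(** Positive entries of M thus remain positive in the quotient, which is what
    [period_irreducible] rests on. *)
Lemma quot_mx_ge x y : M x y <= quot_mx G M (orbit_index x) (orbit_index y).
Proof.
rewrite (quot_mxE _ Minv (x := x)) ?mem_orbit_val //.
by rewrite (bigD1 y) ?mem_orbit_val //= lerDl sumr_ge0.
Qed.

Lemma quot_mx_stochastic :
  (forall x, \sum_y M x y = 1) -> stochastic (quot_mx G M).
Proof.
move=> M1; split=> [i j|]; first exact: quot_mx_ge0.
apply/matrixP => i k; rewrite ord1; have [x <-] := orbit_index_surj i.
by rewrite quot_mx_mul mxE -[RHS](M1 x); apply: eq_bigr => y _; rewrite mxE mulr1.
Qed.

End Lumping.

(** Any configuration is reached from any other by flipping one by one the
    players on whom the two disagree. *)
Lemma flip_connect N (I : finType) (e : rel I) (f : config N -> I) :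
  (forall x i, e (f x) (f (flip x i))) -> forall x y, connect e (f x) (f y).
Proof.
move=> ef x y; move: {2}#|_| (leqnn #|[set i | x i != y i]%SET|) => n.
elim: n x => [|n IHn] x.
  rewrite leqn0 cards_eq0 => /eqP/setP xy.
  suff -> : x = y by [].
  by apply/ffunP => i; have := xy i; rewrite !inE => /negbFE/eqP.
case: (set_0Vmem [set i | x i != y i]%SET) => [A0 _|[i]].
  by apply: IHn; rewrite A0 cards0.
rewrite inE => xyi card_le; apply: connect_trans (connect1 (ef x i)) (IHn _ _).
rewrite -ltnS (leq_trans _ card_le) // proper_card //; apply/properP; split.
  apply/fintype.subsetP => j; rewrite !inE ffunE; case: (eqVneq j i) => [->|//].
  by rewrite xyi.
exists i; rewrite inE // ffunE eqxx; move: xyi.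
by case: (x i); case: (y i).
Qed.

Section PositiveProducts.
Variables (R : realFieldType) (n : nat).
Implicit Types A B : 'M[R]_n.

Lemma mulmx_gt0 A B i j : (forall i j, 0 <= A i j) -> (forall i j, 0 <= B i j) ->
  0 < A i j -> 0 < B j j -> 0 < (A *m B) i j.
Proof.
move=> A0 B0 Aij Bjj; rewrite mxE (bigD1 j) //= ltr_wpDr ?mulr_gt0 //.
by rewrite sumr_ge0 // => k _; rewrite mulr_ge0.
Qed.

Lemma expmx_diag_gt0 A k i : stochastic A -> (forall i, 0 < A i i) ->
  0 < (A ^+ k) i i.
Proof.
move=> As Ad; elim: k => [|k IHk]; first by rewrite expr0 -[1]/(1%:M) mxE eqxx ltr01.
by rewrite exprS; apply: mulmx_gt0 => //; [case: As | case: (stochasticX k As)].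
Qed.

End PositiveProducts.

Section QuotientGame.
Variables (R : realType) (N : nat) (G : {group {perm 'I_N}}) (p : 'I_4 -> R).
Hypotheses (N_gt0 : (0 < N)%N) (p01 : forall m, 0 < p m < 1).
Hypothesis inv : invariant_mx G (@P_B R N p).

Local Notation M := (quot_mx G (P_B p)).

Lemma quot_P_B_stochastic : stochastic M.
Proof.
by apply: quot_mx_stochastic => // [x y|x]; [exact: P_B_ge0 | exact: P_B_sum1].
Qed.

Lemma quot_P_B_flip_gt0 x i :
  0 < M (orbit_index G x) (orbit_index G (flip x i)).
Proof.
apply: lt_le_trans (quot_mx_ge inv _ x _) => [|y z]; last exact: P_B_ge0.
by apply: (P_B_gt0 N_gt0 p01 (i := i)); left.
Qed.

Lemma quot_P_B_diag_gt0 j : 0 < M j j.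
Proof.
have [x <-] := orbit_index_surj j.
apply: lt_le_trans (quot_mx_ge inv _ x _) => [|y z]; last exact: P_B_ge0.
by apply: (P_B_gt0 N_gt0 p01 (i := Ordinal N_gt0)); right.
Qed.

End QuotientGame.

(** Every transition by one flip has positive probability under the first
    factor, and all the other factors may stand still. *)
Lemma period_irreducible (R : realType) (N : nat) (G : {group {perm 'I_N}})
    (p p' : 'I_4 -> R) (r s : nat) : (0 < N)%N -> (0 < r)%N ->
  (forall m, 0 < p m < 1) -> (forall m, 0 < p' m < 1) ->
  invariant_mx G (@P_B R N p) -> invariant_mx G (@P_B R N p') ->
  irreducible (quot_mx G (P_B p) ^+ r *m quot_mx G (P_B p') ^+ s).
Proof.
move=> N_gt0 r_gt0 p01 p'01 inv inv'.
have Ms := quot_P_B_stochastic N_gt0 p01 inv.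
have Ms' := quot_P_B_stochastic N_gt0 p'01 inv'.
move=> j k; have [x <-] := orbit_index_surj j; have [y <-] := orbit_index_surj k.
apply: flip_connect => {}x i.
apply: mulmx_gt0 (expmx_diag_gt0 _ _ Ms' (quot_P_B_diag_gt0 N_gt0 p'01 inv')).
- exact: (proj1 (stochasticX _ Ms)).
- exact: (proj1 (stochasticX _ Ms')).
rewrite -(prednK r_gt0) exprS.
apply: mulmx_gt0 (expmx_diag_gt0 _ _ Ms (quot_P_B_diag_gt0 N_gt0 p01 inv)).
- exact: (proj1 Ms).
- exact: (proj1 (stochasticX _ Ms)).
exact: quot_P_B_flip_gt0.
Qed.

(** * Labelled players and the strong law *)

Section LiftToPlayers.
Variables (R : realType) (N : nat) (game : nat -> 'I_4 -> R) (mu : R).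
Variable h : nat -> config N -> R.
Hypothesis N_gt0 : (0 < N)%N.
Hypothesis h_poisson : forall n x, h n x =
  \sum_y Pdot_B (game n) x y + \sum_y P_B (game n) x y * h n.+1 y - mu.

(** A solution on pairs (configuration, player) obtained from the one on
    configurations by one step of the recursion. The first term
    2 * game n m - 1 is the expected payoff: p_m - q_m whatever the status. *)
Definition player_solution n (a : config N * 'I_N) : R :=
  2 * game n (nbhd a.1 a.2) - 1 - mu +
  \sum_b Pstar_B (game n) a b * h n.+1 b.1.

Lemma player_solutionE n x i : player_solution n (x, i) =
  2 * game n (nbhd x i) - 1 - mu +
  (flip_prob (game n) x i * h n.+1 (flip x i) +
   (1 - flip_prob (game n) x i) * h n.+1 x).
Proof.
by rewrite /player_solution (Pstar_mul _ _ _ (fun b => h n.+1 b.1)) /= !avg_const.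
Qed.

(** The next player is uniform, so only this average enters the recursion one
    step earlier; that is what makes [player_poisson] hold. *)
Lemma player_solution_avg n x :
  N%:R^-1 * \sum_i player_solution n (x, i) = h n x.
Proof.
rewrite h_poisson Pdot_B_sum P_B_mul -[X in _ = _ - X](avg_const N_gt0).
rewrite -mulrDr -mulrBr -big_split -sumrB; congr (_ * _); apply: eq_bigr => i _.
by rewrite player_solutionE /=; ring.
Qed.

Lemma player_poisson n a :
  \sum_b Pstar_B (game n) a b * (payoff R a b + player_solution n.+1 b) =
  mu + player_solution n a.
Proof.
case: a => x i; under eq_bigr do rewrite mulrDr.
rewrite big_split /= Pstar_payoff // Pstar_mul !player_solution_avg player_solutionE.
by ring.
Qed.

End LiftToPlayers.

Lemma payoff_le1 (R : realType) N (a b : config N * 'I_N) : `|payoff R a b| <= 1.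
Proof.
case: a b => x i [y j] /=.
by do 2?case: ifP => _; do ?case: ifP => _; rewrite ?normrN ?normr1 ?normr0.
Qed.

Theorem theorem5 (R : realType) (N : nat) (p : 'I_4 -> R)
    (G : {group {perm 'I_N}}) (r s : nat)
    (hN : (3 <= N)%N)
    (hp : forall m, 0 < p m < 1)
    (hG : G = rotations N \/ p (inord 1) = p (inord 2) /\ G = dihedral N)
    (hr : (1 <= r)%N) (hs : (1 <= s)%N) :
  let PA := quot_mx G (@P_A R N) in
  let PB := quot_mx G (@P_B R N p) in
  let PdotB := quot_mx G (@Pdot_B R N p) in
  exists pi : 'rV[R]_#|orbits G|,
    [/\ stationary (PA ^+ r *m PB ^+ s) pi,
        forall pi', stationary (PA ^+ r *m PB ^+ s) pi' -> pi' = pi &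
        let mu := (r + s)%:R^-1 *
          \sum_(0 <= v < s)
             (pi *m PA ^+ r *m PB ^+ v *m PdotB *m (const_mx 1 : 'cV[R]__)) 0 0 in
        forall (d : measure_display) (T : measurableType d)
          (P : probability T R)
          (X : nat -> T -> config N) (I : nat -> T -> 'I_N),
          markov_chain P (fun n t => (X n t, I n t)) (periodic_kernel p r s) ->
          {ae P, forall t,
             (fun n : nat => n%:R^-1 * total_profit R X I n t) @ \oo --> mu}].
Proof.
move=> PA PB PdotB; have N_gt0 : (0 < N)%N by exact: leq_trans hN.
have fair01 m : 0 < fair R m < 1 by rewrite /fair; lra.
have inv_B : invariant_mx G (P_B p).
  case: hG => [->|[p12 ->]]; first exact: walk_mx_rotations.
  by apply: walk_mx_dihedral; rewrite ?p12.
have inv_dot : invariant_mx G (Pdot_B p).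
  case: hG => [->|[p12 ->]]; first exact: walk_mx_rotations.
  by apply: walk_mx_dihedral; rewrite ?p12.
have inv_A : invariant_mx G (@P_A R N).
  by case: hG => [->|[_ ->]]; [exact: walk_mx_rotations|exact: walk_mx_dihedral].
have PBs : stochastic PB by exact: quot_P_B_stochastic.
have PAs : stochastic PA by exact: quot_P_B_stochastic.
set Q := PA ^+ r *m PB ^+ s.
have Qs : stochastic Q by apply: stochasticM; exact: stochasticX.
have Qi : irreducible Q by exact: period_irreducible.
pose i0 := orbit_index G [ffun=> false].
exists (stationary_vector Q); split.
- split=> [k||].
  + apply: (fixed_ge0 i0 Qs Qi); first exact: stationary_vector_fixed.
    exact: stationary_vector_sum.
  + exact: (stationary_vector_sum i0 Qs Qi).
  + exact: (stationary_vector_fixed i0 Qs Qi).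
- by move=> v [_ v1 vQ]; exact: (stationary_vector_unique i0 Qs Qi).
move=> mu d T P X I chain.
pose c := (r + s)%N; have c0 : (0 < c)%N by rewrite addn_gt0 hr.
pose game n : 'I_4 -> R := if (n %% c < r)%N then fair R else p.
have [|h hE hper] := periodic_poisson (g := PdotB *m const_mx 1) (mu := mu) i0 c0
  PAs PBs Qi (stationary_vector_fixed i0 Qs Qi) (stationary_vector_sum i0 Qs Qi).
  by congr (_ * _); apply: eq_bigr => v _; rewrite !mulmxA.
pose f n x := h n (orbit_index G x) 0.
(* The fair game contributes no payoff, so the two branches of hE agree with
   the single recursion written in terms of the game played at time n. *)
have fE n x : f n x =
    \sum_y Pdot_B (game n) x y + \sum_y P_B (game n) x y * f n.+1 y - mu.
  have fair_dot : \sum_y Pdot_B (fair R) x y = 0.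
    rewrite Pdot_B_sum big1 ?mulr0 // => i _.
    by rewrite /fair mulfV ?subrr // pnatr_eq0.
  rewrite /f hE /game -/c; case: ifP => _.
    by rewrite mxE quot_mx_mul // [X in _ + X]mxE mxE fair_dot add0r.
  rewrite mxE [X in X + _]mxE !quot_mx_mul // [X in _ + X]mxE mxE.
  by congr (_ + _ - _); apply: eq_bigr => y _; rewrite mxE mulr1.
have game_step n : game n = game (n %% c)%N by rewrite /game modn_mod.
have f_step n : f n.+1 = f (n %% c).+1.
  by apply: funext => x; rewrite /f hper modnS_mod -hper.
have [CH CHb] : exists C, forall n a, `|player_solution game mu f n a| <= C.
  apply: periodic_bounded c0 _ => n; apply: funext => a.
  by rewrite /player_solution game_step f_step.
have kernelE n : periodic_kernel p r s n = Pstar_B (game n).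
  by rewrite /periodic_kernel /game -/c; case: ifP.
have game01 n m : 0 < game n m < 1 by rewrite /game; case: ifP.
have : {ae P, forall t, (fun n : nat => n%:R^-1 * \sum_(0 <= k < n)
    payoff R (X k t, I k t) (X k.+1 t, I k.+1 t)) @ \oo --> mu}.
  apply: (poisson_strong_law (mu := mu) chain _ _ _ CHb) => [n a b|n a|a b|n a].
  - by rewrite kernelE; exact: Pstar_ge0.
  - by rewrite kernelE; exact: Pstar_sum1.
  - exact: payoff_le1.
  - by rewrite kernelE; exact: player_poisson.
apply: filterS => t /= lim_t.
have -> : (fun n : nat => n%:R^-1 * total_profit R X I n t) =
    (fun n : nat => n%:R^-1 * \sum_(0 <= k < n)
       payoff R (X k t, I k t) (X k.+1 t, I k.+1 t)).
  by apply: funext => n; rewrite /total_profit big_add1.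
exact: lim_t.
Qed.
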